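(* Let $2 < p < \infty$. Then the metric space $(\mathrm{Dgm}_p, w_p)$ of persistence diagrams with the $p$-Wasserstein metric does not coarsely embed into a Hilbert space; that is, there is no Hilbert space $H$ admitting a coarse embedding $(\mathrm{Dgm}_p, w_p) \to H$.
   Context: Persistence diagrams. Let $\mathbb{R}^2_< = \{(x,y)\in\mathbb{R}^2 \mid x<y\}$. A persistence diagram is a function $D: I \to \mathbb{R}^2_<$ from a countable (possibly finite or empty) set $I$; write $D(i) = (D(i)_x, D(i)_y)$. The symbol $\emptyset$ denotes the unique persistence diagram with empty indexing set. Partial matchings. A partial matching between persistence diagrams $D_1: I_1 \to \mathbb{R}^2_<$ and $D_2: I_2\to\mathbb{R}^2_<$ is a triple $(I_1', I_2', f)$ with $I_1'\subseteq I_1$, $I_2'\subseteq I_2$ and $f: I_1'\to I_2'$ a bijection. For $1\le p<\infty$ its $p$-cost (possibly $+\infty$) is $$\mathrm{cost}_p(f) = \left( \sum_{i \in I_1'} \|D_1(i) - D_2(f(i))\|_{\infty}^p + \sum_{i \in I_1 \setminus I_1'} \left( \frac{D_1(i)_y - D_1(i)_x}{2} \right)^p + \sum_{i \in I_2 \setminus I_2'} \left( \frac{D_2(i)_y - D_2(i)_x}{2} \right)^p\right)^{1/p},$$ where $\|\cdot\|_\infty$ is the max norm on $\mathbb{R}^2$. The metric space. For $1\le p<\infty$ let $\tilde w_p(D_1,D_2) = \inf\{\mathrm{cost}_p(f) \mid f \text{ is a partial matching between } D_1 \text{ and } D_2\}$. Then $(\mathrm{Dgm}_p, w_p)$ is the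 metric space of persistence diagrams $D$ satisfying $\tilde w_p(D,\emptyset)<\infty$, modulo the relation $D_1\sim D_2$ iff $\tilde w_p(D_1,D_2)=0$, with the metric $w_p$ induced by $\tilde w_p$. Coarse embeddings. A map $f:(X,d)\to(Y,d')$ between metric spaces is a coarse embedding if there exist non-decreasing functions $\rho_-,\rho_+:[0,\infty)\to[0,\infty)$ such that $\rho_-(d(x,y))\le d'(f(x),f(y))\le\rho_+(d(x,y))$ for all $x,y\in X$, and $\lim_{t\to\infty}\rho_-(t)=\infty$. A Hilbert space is regarded as a metric space via its norm. *)

(* Defs.v *)
From HB Require Import structures.
From mathcomp Require Import all_boot all_order all_algebra.
From mathcomp Require Import generic_quotient.
From mathcomp Require Import all_classical all_reals all_analysis.
From mathcomp Require Import complex ring.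

Set Implicit Arguments.
Unset Strict Implicit.
Unset Printing Implicit Defensive.

Import Order.TTheory GRing.Theory Num.Theory.
Import numFieldNormedType.Exports.

Local Open Scope classical_set_scope.
Local Open Scope ring_scope.

Record pdiagram (R : realType) := PDiagram {
  pd_index : Type ;
  pd_point :> pd_index -> R * R ;
  pd_countable : countable [set: pd_index] ;
  pd_lt : forall i, (pd_point i).1 < (pd_point i).2 }.

HB.instance Definition _ (R : realType) := gen_eqMixin (pdiagram R).
HB.instance Definition _ (R : realType) := gen_choiceMixin (pdiagram R).

(* Unordered sums range over a [choiceType]. *)
HB.instance Definition _ (R : realType) (D : pdiagram R) :=
  gen_eqMixin (pd_index D).
HB.instance Definition _ (R : realType) (D : pdiagram R) :=
  gen_choiceMixin (pd_index D).

Definition pd_empty (R : realType) : pdiagram R :=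
  @PDiagram R void (fun i => match i with end) (countableP _)
    (fun i => match i with end).

(* The subsets [pm_dom] and [pm_cod] are used as the types of their elements. *)
Record pmatching (R : realType) (D1 D2 : pdiagram R) := PMatching {
  pm_dom : set (pd_index D1) ;
  pm_cod : set (pd_index D2) ;
  pm_fun : pm_dom -> pm_cod ;
  pm_bij : bijective pm_fun }.

Section cost.
Context {R : realType} (p : R).
Implicit Types D : pdiagram R.

Definition pers D (i : pd_index D) : R := ((D i).2 - (D i).1) / 2.

(* The norm of [R * R] is the max norm; [\esum] is the unordered sum of
   nonnegative terms. *)
Definition pm_cost D1 D2 (M : pmatching D1 D2) : \bar R :=
  ((\esum_(i in [set: pm_dom M])
      (`|D1 (val i) - D2 (val (pm_fun i))| `^ p)%:E +
    \esum_(i in ~` pm_dom M) (pers i `^ p)%:E +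
    \esum_(j in ~` pm_cod M) (pers j `^ p)%:E) `^ p^-1)%E.

Definition wasserstein D1 D2 : \bar R :=
  ereal_inf [set pm_cost M | M in [set: pmatching D1 D2]].

(* For the triangle inequality, a matching is encoded by its graph, a relation
   between the two index sets extended with [None], which stands for the
   diagonal. *)
Local Notation oidx D := (option (pd_index D)).

Definition odist D1 D2 (e : oidx D1 * oidx D2) : R :=
  match e with
  | (Some i, Some j) => `|D1 i - D2 j|
  | (Some i, None) => pers i
  | (None, Some j) => pers j
  | (None, None) => 0
  end.

Definition is_graph D1 D2 (G : set (oidx D1 * oidx D2)) :=
  [/\ forall i, exists! b, G (Some i, b),
      forall j, exists! a, G (a, Some j) & ~ G (None, None)].

Definition gsum D1 D2 (G : set (oidx D1 * oidx D2)) : \bar R :=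
  \esum_(e in G) (odist e `^ p)%:E.

Definition pm_graph D1 D2 (M : pmatching D1 D2) : set (oidx D1 * oidx D2) :=
  [set (Some (val i), Some (val (pm_fun i))) | i in [set: pm_dom M]] `|`
  [set (Some i, None) | i in ~` pm_dom M] `|`
  [set (None, Some j) | j in ~` pm_cod M].

Let esumU (T : choiceType) (A B : set T) (f : T -> \bar R) :
    (forall x, 0 <= f x)%E -> A `&` B = set0 ->
  (\esum_(x in A `|` B) f x = \esum_(x in A) f x + \esum_(x in B) f x)%E.
Proof.
move=> f0 AB0; rewrite (esumID A) //; congr (_ + _)%E; congr (esum _ _).
  by rewrite setIUl setIid [B `&` A]setIC AB0 setU0.
by rewrite setIUl setICr set0U; apply/setIidl => x Bx Ax;
  have : (A `&` B) x by []; rewrite AB0.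
Qed.

Lemma pm_costE D1 D2 (M : pmatching D1 D2) :
  pm_cost M = (gsum (pm_graph M) `^ p^-1)%E.
Proof.
have f0 (e : oidx D1 * oidx D2) : (0 <= (odist e `^ p)%:E)%E.
  by rewrite lee_fin powR_ge0.
rewrite /gsum /pm_graph esumU//; last first.
  by apply/seteqP; split => // e [[[i _ <-]|[i _ <-]] [j _]].
rewrite esumU//; last first.
  by apply/seteqP; split => // e [[i _ <-] [j _]].
congr (poweR (_ + _ + _)%E _).
- rewrite esum_image// => i j _ _ [].
  by move=> /val_inj.
- by rewrite esum_image// => i j _ _ [].
- by rewrite esum_image// => i j _ _ [].
Qed.

Lemma pm_graphP D1 D2 (M : pmatching D1 D2) : is_graph (pm_graph M).
Proof.
case: M => A B f [g fK gK]; split => /=.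
- move=> i; have [Ai|nAi] := pselect (A i).
    pose i' : A := exist _ i (mem_set Ai).
    exists (Some (val (f i'))); split; first by left; left; exists i'.
    move=> b [[[k _ [ki <-]]|[k nk [ki _]]]|[k _ []//]].
      by congr (Some (val (f _))); apply: val_inj.
    by exfalso; apply: nk; rewrite ki.
  exists None; split; first by left; right; exists i.
  move=> b [[[k _ [ki _]]|[k nk [ki <-]]]|[k _ []//]] //.
  by exfalso; apply: nAi; rewrite -ki; exact: set_valP.
- move=> j; have [Bj|nBj] := pselect (B j).
    pose j' : B := exist _ j (mem_set Bj).
    exists (Some (val (g j'))); split.
      by left; left; exists (g j') => //=; rewrite gK.
    move=> b [[[k _ [<- kj]]|[k _ [_ //]]]|[k nk [_ kj]]].
      congr (Some (val _)); rewrite -(fK k); congr g; exact: val_inj.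
    by exfalso; apply: nk; rewrite kj.
  exists None; split; first by right; exists j.
  move=> b [[[k _ [_ kj]]|[k _ [_ //]]]|[k nk [<- //]]].
  by exfalso; apply: nBj; rewrite -kj; exact: set_valP.
- by move=> [[[k _ []]|[k _ []]]|[k _ []]].
Qed.

Lemma graph_pmP D1 D2 (G : set (oidx D1 * oidx D2)) : is_graph G ->
  exists M : pmatching D1 D2, pm_graph M = G.
Proof.
move=> [G1 G2 G0].
pose A := [set i | exists j, G (Some i, Some j)].
pose B := [set j | exists i, G (Some i, Some j)].
have Gf i b b' : G (Some i, b) -> G (Some i, b') -> b = b'.
  by have [c [_ cu]] := G1 i => /cu <- /cu <-.
have Gg j a a' : G (a, Some j) -> G (a', Some j) -> a = a'.
  by have [c [_ cu]] := G2 j => /cu <- /cu <-.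
have fP (i : A) : {j : B | G (Some (val i), Some (val j))}.
  apply: cid; have [j Gij] := set_valP i.
  have Bj : B j by exists (val i).
  by exists (exist _ j (mem_set Bj)).
have gP (j : B) : {i : A | G (Some (val i), Some (val j))}.
  apply: cid; have [i Gij] := set_valP j.
  have Ai : A i by exists (val j).
  by exists (exist _ i (mem_set Ai)).
pose f i := sval (fP i); pose g j := sval (gP j).
have fg : bijective f.
  exists g => [i|j]; apply: val_inj.
    by apply: Some_inj; apply: Gg (svalP (gP (f i))) (svalP (fP i)).
  by apply: Some_inj; apply: Gf (svalP (fP (g j))) (svalP (gP j)).
exists (PMatching fg); apply/seteqP; split => /=.
  move=> e [[[i _ <-]|[i nAi <-]]|[j nBj <-]] /=.
  - exact: svalP (fP i).
  - have [[j|] [Gib _]] := G1 i; last by [].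
    by exfalso; apply: nAi; exists j.
  - have [[i|] [Gaj _]] := G2 j; last by [].
    by exfalso; apply: nBj; exists i.
move=> [[i|] [j|]] Gij //.
- have Ai : A i by exists j.
  left; left; exists (exist _ i (mem_set Ai)) => //=; congr pair.
  by apply: Gf Gij; exact: svalP (fP (exist _ i (mem_set Ai))).
- by left; right; exists i => // -[j /(Gf _ _ _ Gij)].
- by right; exists j => // -[i /(Gg _ _ _ Gij)].
Qed.

Lemma wassersteinE D1 D2 : wasserstein D1 D2 =
  ereal_inf [set (gsum G `^ p^-1)%E | G in @is_graph D1 D2].
Proof.
congr ereal_inf; apply/seteqP; split => x.
  by move=> [M _ <-]; exists (pm_graph M); [exact: pm_graphP|rewrite pm_costE].
by move=> [G /graph_pmP[M <-] <-]; exists M => //; rewrite pm_costE.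
Qed.

Lemma wasserstein_ge0 D1 D2 : (0 <= wasserstein D1 D2)%E.
Proof. by apply: le_ereal_inf_tmp => _ [M _ <-]; exact: poweR_ge0. Qed.

End cost.

Section triangle.
Context {R : realType} (p : R).
Context (p1 : 1 <= p).
Implicit Types D : pdiagram R.

Let p0 : 0 < p. Proof. exact: lt_le_trans p1. Qed.

Local Notation oidx D := (option (pd_index D)).

Let powRD_le (a b u v : R) : 0 < a -> 0 < b -> 0 <= u -> 0 <= v ->
  (u + v) `^ p <= (a + b) `^ p * (a / (a + b) * (u / a) `^ p +
                                  b / (a + b) * (v / b) `^ p).
Proof.
move=> a0 b0 u0 v0; have ab0 : 0 < a + b by rewrite addr_gt0.
have t0 : 0 <= a / (a + b) by rewrite divr_ge0 ?ltW.
have t1 : a / (a + b) <= 1 by rewrite ler_pdivrMr// mul1r lerDl ltW.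
have tE : b / (a + b) = 1 - a / (a + b).
  by apply/eqP; rewrite eq_sym subr_eq -mulrDl addrC divff// gt_eqF.
have -> : u + v = (a + b) * (a / (a + b) * (u / a) + b / (a + b) * (v / b)).
  by field; rewrite ?gt_eqF.
rewrite powRM ?ler_wpM2l ?powR_ge0//; [|exact: ltW|]; last first.
  by rewrite addr_ge0// mulr_ge0// ?divr_ge0// ?ltW// addr_gt0.
rewrite tE; apply: (convex_powR p1 (Itv01 t0 t1)) => //=;
  by rewrite inE/= in_itv/= andbT divr_ge0// ltW.
Qed.

Let esumZl_le (T : choiceType) (A : set T) (c : R) (f : T -> R) :
    0 <= c -> (forall x, 0 <= f x) ->
  (\esum_(x in A) (c * f x)%:E <= c%:E * \esum_(x in A) (f x)%:E)%E.
Proof.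
move=> c0 f0; apply: ge_ereal_sup => _ [X [finX XA] <-].
under eq_fsbigr do rewrite EFinM.
rewrite -ge0_mule_fsumr; last by move=> i; rewrite lee_fin.
apply: lee_wpmul2l; first by rewrite lee_fin.
by apply: ereal_sup_ubound; exists X.
Qed.

Let esum_minkowski (T : choiceType) (A : set T) (a b : R) (u v w : T -> R) :
    0 < a -> 0 < b -> (forall x, 0 <= u x) -> (forall x, 0 <= v x) ->
    (forall x, 0 <= w x) -> (forall x, w x <= u x + v x) ->
    (\esum_(x in A) (u x `^ p)%:E <= (a `^ p)%:E)%E ->
    (\esum_(x in A) (v x `^ p)%:E <= (b `^ p)%:E)%E ->
  (\esum_(x in A) (w x `^ p)%:E <= ((a + b) `^ p)%:E)%E.
Proof.
move=> a0 b0 u0 v0 w0 wuv ua vb; have ab0 : 0 < a + b by rewrite addr_gt0.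
pose k c : R := (a + b) `^ p * (c / (a + b)) / c `^ p.
have k0 c : 0 < c -> 0 <= k c.
  by move=> c0; rewrite divr_ge0 ?powR_ge0// mulr_ge0 ?powR_ge0// divr_ge0// ltW.
apply: (@le_trans _ _ (\esum_(x in A) ((k a * u x `^ p)%:E + (k b * v x `^ p)%:E))%E).
  apply: le_esum => x _; rewrite -EFinD lee_fin.
  have -> : k a * u x `^ p + k b * v x `^ p =
     (a + b) `^ p * (a / (a + b) * (u x / a) `^ p + b / (a + b) * (v x / b) `^ p).
    have kE c y : 0 < c -> 0 <= y ->
        k c * y `^ p = (a + b) `^ p * (c / (a + b) * (y / c) `^ p).
      move=> c0 y0; rewrite powRM ?invr_ge0 ?(ltW c0)//.
      have -> : c^-1 `^ p = (c `^ p)^-1.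
        by rewrite -(powR_inv1 (ltW c0)) -powRrM mulN1r powRN.
      rewrite /k -!mulrA; do 3 congr (_ * _).
      by rewrite mulrC.
    by rewrite !kE// mulrDr.
  apply: le_trans (powRD_le a0 b0 (u0 x) (v0 x)).
  by rewrite ge0_ler_powR ?nnegrE ?addr_ge0// ltW.
rewrite esumD; [|by move=> x _; rewrite lee_fin mulr_ge0 ?powR_ge0// k0..].
have H c f : 0 < c -> (\esum_(x in A) (f x `^ p)%:E <= (c `^ p)%:E)%E ->
    (\esum_(x in A) (k c * f x `^ p)%:E <=
      ((a + b) `^ p * (c / (a + b)))%:E)%E.
  move=> c0 fc; apply: le_trans (esumZl_le _ (k0 _ c0) _) _.
    by move=> x; exact: powR_ge0.
  apply: (@le_trans _ _ ((k c)%:E * (c `^ p)%:E)%E).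
    by rewrite lee_wpmul2l// lee_fin k0.
  by rewrite -EFinM lee_fin /k divfK// gt_eqF// powR_gt0.
apply: le_trans (leeD (H _ _ a0 ua) (H _ _ b0 vb)) _.
by rewrite -EFinD lee_fin -mulrDr -mulrDl divff ?mulr1// gt_eqF.
Qed.

Let odist_ge0 D1 D2 (e : oidx D1 * oidx D2) : 0 <= odist e.
Proof.
have P D (i : pd_index D) : 0 <= pers i.
  by rewrite divr_ge0// subr_ge0 ltW// pd_lt.
by case: e => [[i|] [j|]] /=.
Qed.

Let odist_triangle D1 D2 D3 (a : oidx D1) (b : oidx D2) (c : oidx D3) :
    b <> None \/ a = None \/ c = None ->
  odist (a, c) <= odist (a, b) + odist (b, c).
Proof.
have P D (i : pd_index D) : 0 <= pers i.
  by rewrite divr_ge0// subr_ge0 ltW// pd_lt.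
have Q D D' (i : pd_index D) (j : pd_index D') : pers i <= `|D i - D' j| + pers j.
  rewrite -lerBlDr /pers -mulrBl ler_pdivrMr// prod_normE /=.
  set x := D i; set y := D' j.
  have -> : x.2 - x.1 - (y.2 - y.1) = (x.2 - y.2) - (x.1 - y.1).
    by rewrite opprB opprB addrACA [RHS]addrACA; congr (_ + _); rewrite addrC.
  apply: le_trans (ler_norm _) _; apply: le_trans (ler_normB _ _) _.
  rewrite mulr_natr mulr2n lerD// le_max lexx ?orbT//.
move: a b c => [i|] [j|] [k|] /=; rewrite ?addr0 ?add0r ?addr_ge0// => H.
- by apply: le_trans (ler_normD _ _); rewrite addrA subrK.
- by case: H => // -[].
- by rewrite distrC addrC.
Qed.

Lemma wasserstein_triangle D1 D2 D3 :
  (wasserstein p D1 D3 <= wasserstein p D1 D2 + wasserstein p D2 D3)%E.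
Proof.
have nNy D D' : wasserstein p D D' != -oo%E.
  by have := wasserstein_ge0 p D D'; case: wasserstein.
have [->|/eqP w12] := eqVneq (wasserstein p D1 D2) +oo%E; first by rewrite addye ?leey.
have [->|/eqP w23] := eqVneq (wasserstein p D2 D3) +oo%E; first by rewrite addey ?leey.
have fin (x : \bar R) : (0 <= x)%E -> x <> +oo%E -> x \is a fin_num by case: x.
have {w12}f12 := fin _ (wasserstein_ge0 p D1 D2) w12.
have {w23}f23 := fin _ (wasserstein_ge0 p D2 D3) w23.
apply/lee_addgt0Pr => e e0; have e20 : 0 < e / 2 by rewrite divr_gt0.
have gr D D' : wasserstein p D D' \is a fin_num ->
    exists2 c : R, 0 < c & exists2 G : set (oidx D * oidx D'),
      is_graph G & (gsum p G <= (c `^ p)%:E)%E /\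
      (c%:E <= wasserstein p D D' + (e / 2)%:E)%E.
  move=> fw; have := fw; rewrite wassersteinE => fw'.
  have [_ [G Gg <-]] := lb_ereal_inf_adherent e20 fw'.
  rewrite -wassersteinE => Glt; exists (fine (wasserstein p D D') + e / 2).
    by rewrite ltr_wpDl// fine_ge0// wasserstein_ge0.
  exists G => //; split; last by rewrite EFinD fineK.
  have G0 : (0 <= gsum p G)%E by apply: esum_ge0 => x _; rewrite lee_fin powR_ge0.
  have -> : gsum p G = ((gsum p G `^ p^-1) `^ p)%E.
    by rewrite -poweRrM mulVf ?gt_eqF// poweRe1.
  have [pge0 Glt'] := (ltW p0, ltW Glt).
  rewrite -poweR_EFin; apply: gt0_ler_poweR; rewrite ?in_itv/= ?leey ?andbT//.
  - exact: poweR_ge0.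
  - by rewrite lee_fin addr_ge0 ?(ltW e20)// fine_ge0// wasserstein_ge0.
  - by rewrite EFinD fineK.
have [a a0 [G1 G1g [G1a alt]]] := gr _ _ f12.
have [b b0 [G2 G2g [G2b blt]]] := gr _ _ f23.
have [[G1l G1r G10] [G2l G2r G20]] := (G1g, G2g).
have Gf D D' (G : set (oidx D * oidx D')) i c c' : is_graph G ->
    G (Some i, c) -> G (Some i, c') -> c = c'.
  by move=> [/(_ i) [d [_ du]] _ _] => /du <- /du <-.
have Gg D D' (G : set (oidx D * oidx D')) j c c' : is_graph G ->
    G (c, Some j) -> G (c', Some j) -> c = c'.
  by move=> [_ /(_ j) [d [_ du]] _] => /du <- /du <-.
(* the chains of two consecutive edges, glued along the points of [D2] *)
pose W : set (oidx D1 * oidx D2 * oidx D3) := fun x =>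
  match x.1.2, x.1.1, x.2 with
  | Some j, a, c => G1 (a, Some j) /\ G2 (Some j, c)
  | None, Some i, None => G1 (Some i, None)
  | None, None, Some k => G2 (None, Some k)
  | _, _, _ => False
  end.
pose pr13 (x : oidx D1 * oidx D2 * oidx D3) := (x.1.1, x.2).
pose pr23 (x : oidx D1 * oidx D2 * oidx D3) := (x.1.2, x.2).
pose G3 := pr13 @` (W `&` [set x | pr13 x <> (None, None)]).
have esumS (T T' : choiceType) (A : set T) (P : set T') (h : T -> T') (g : T' -> \bar R) :
    (forall x, 0 <= g x)%E ->
    (forall x y, A x -> A y -> P (h x) -> h x = h y -> x = y) ->
    (forall y, P y -> exists2 x, A x & h x = y) ->
    (forall x, A x -> ~ P (h x) -> g (h x) = 0%E) ->
    (\esum_(x in A) g (h x) = \esum_(y in P) g y)%E.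
  move=> g0 hi hs h0; rewrite (esumID (h @^-1` P))// [X in (_ + X)%E]esum1 ?adde0.
    rewrite -esum_image; last first.
      by move=> x y /[!inE] -[Ax Px] [Ay _]; exact: hi.
    congr esum; apply/seteqP; split => [_ [x [_ Px] <-]//|y Py].
    by have [x Ax xy] := hs _ Py; exists x => //; split => //=; rewrite xy.
  by move=> x [Ax nPx]; exact: h0.
have f0 D D' (x : oidx D * oidx D') : (0 <= (odist x `^ p)%:E)%E.
  by rewrite lee_fin powR_ge0.
have W1 : (\esum_(x in W) (odist x.1 `^ p)%:E = gsum p G1)%E.
  apply: (esumS _ _ W G1 fst (fun y => (odist y `^ p)%:E)) => //.
  - move=> [[x1 x2] x3] [[y1 y2] y3] Wx Wy Gx [e1 e2]; congr pair; first by congr pair.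
    move: y1 y2 e1 e2 Wy => _ _ <- <-; move: Wx Gx => /=.
    case: x2 => [j|]; first by move=> [_ H] _ [_ H']; exact: (Gf _ _ _ _ _ _ G2g H H').
    by case: x1 => [i|//]; case: x3 => //; case: y3.
  - move=> [a' [j|]]; first by move=> H; have [c [Gc _]] := G2l j; exists (a', Some j, c).
    by case: a' => // i H; exists (Some i, None, None).
  - move=> [[[i|] [j|]] [k|]] //=; try by move=> [].
    by move=> _ _; rewrite powR0// gt_eqF.
have W2 : (\esum_(x in W) (odist (pr23 x) `^ p)%:E = gsum p G2)%E.
  apply: (esumS _ _ W G2 pr23 (fun y => (odist y `^ p)%:E)) => //.
  - move=> [[x1 x2] x3] [[y1 y2] y3] Wx Wy Gx [e1 e2]; congr pair => //; congr pair => //.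
    move: y3 y2 e1 e2 Wy => _ _ <- <-; move: Wx Gx => /=.
    case: x2 => [j|]; first by move=> [H _] _ [H' _]; exact: (Gg _ _ _ _ _ _ G1g H H').
    by case: x3 => [i|]; case: x1 => //; case: y1.
  - move=> [[j|] c]; first by move=> H; have [a' [Ga _]] := G1r j; exists (a', Some j, c).
    by case: c => // k H; exists (None, None, Some k).
  - move=> [[[i|] [j|]] [k|]] //=; try by move=> [].
    by move=> _ _; rewrite powR0// gt_eqF.
have W3 : (\esum_(x in W) (odist (pr13 x) `^ p)%:E = gsum p G3)%E.
  apply: (esumS _ _ W G3 pr13 (fun y => (odist y `^ p)%:E)) => //.
  - move=> [[x1 x2] x3] [[y1 y2] y3] Wx Wy [z [_ z0] zx] [e1 e2].
    move: z0; rewrite /= zx /pr13/= {z zx} => z0.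
    move: y1 y3 e1 e2 Wy => _ _ <- <- Wy; congr (_, _, _).
    move: x1 x3 x2 y2 Wx Wy z0 => [i|] [k|] [j|] [j'|] //=.
    + by move=> [H _] [H' _] _; rewrite (Gf _ _ _ _ _ _ G1g H H').
    + by move=> [H _] [H' _] _; rewrite (Gf _ _ _ _ _ _ G1g H H').
    + by move=> [H _] H' _; rewrite (Gf _ _ _ _ _ _ G1g H H').
    + by move=> H [H' _] _; rewrite (Gf _ _ _ _ _ _ G1g H H').
    + by move=> [_ H] [_ H'] _; rewrite (Gg _ _ _ _ _ _ G2g H H').
    + by move=> [_ H] H' _; rewrite (Gg _ _ _ _ _ _ G2g H H').
    + by move=> H [_ H'] _; rewrite (Gg _ _ _ _ _ _ G2g H H').
  - by move=> _ [x [Wx _] <-]; exists x.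
  - move=> x Wx; have [->|/eqP n0] := eqVneq (pr13 x) (None, None).
      by move=> _; rewrite /= powR0// gt_eqF.
    by case; exists x.
have G3g : is_graph G3.
  split.
  - move=> i; have [[j|] [Gi _]] := G1l i.
      have [c [Gc _]] := G2l j; exists c; split.
        by exists (Some i, Some j, c).
      move=> c' [[[i' [j'|]] c''] [Wx _] [ei ec]]; move: Wx; rewrite /W/= ei ec {ei ec}.
        move=> [H H']; have [jj'] := Gf _ _ _ _ _ _ G1g Gi H.
        by rewrite -jj' in H'; exact: Gf G2g Gc H'.
      by case: c' => // H; have := Gf _ _ _ _ _ _ G1g Gi H.
    exists None; split; first by exists (Some i, None, None).
    move=> c' [[[i' [j'|]] c''] [Wx _] [ei ec]]; move: Wx; rewrite /W/= ei ec {ei ec}.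
      by move=> [H _]; have := Gf _ _ _ _ _ _ G1g Gi H.
    by case: c'.
  - move=> k; have [[j|] [Gk _]] := G2r k.
      have [c [Gc _]] := G1r j; exists c; split.
        by exists (c, Some j, Some k).
      move=> c' [[[i' [j'|]] c''] [Wx _] [ei ec]]; move: Wx; rewrite /W/= ei ec {ei ec}.
        move=> [H' H]; have [jj'] := Gg _ _ _ _ _ _ G2g Gk H.
        by rewrite -jj' in H'; exact: Gg G1g Gc H'.
      by case: c' => // H; have := Gg _ _ _ _ _ _ G2g Gk H.
    exists None; split; first by exists (None, None, Some k).
    move=> c' [[[i' [j'|]] c''] [Wx _] [ei ec]]; move: Wx; rewrite /W/= ei ec {ei ec}.
      by move=> [_ H]; have := Gg _ _ _ _ _ _ G2g Gk H.
    by case: c'.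
  - by move=> [x [_ n0] /n0].
have ab : (gsum p G3 <= ((a + b) `^ p)%:E)%E.
  rewrite -W3; apply: (@le_trans _ _ (\esum_(x in W)
      ((if x \in W then odist (pr13 x) else 0) `^ p)%:E)%E).
    by apply: le_esum => x Wx; rewrite (mem_set Wx).
  apply: (esum_minkowski (u := fun x => odist x.1) (v := fun x => odist (pr23 x)));
    rewrite ?W1 ?W2// => x; do ?exact: odist_ge0.
  - by case: ifP => // _; exact: odist_ge0.
  - case: ifPn => [/set_mem|_]; last by rewrite addr_ge0.
    move: x => [[x1 x2] x3] Wx; apply: odist_triangle.
    by move: x1 x2 x3 Wx => [?|] [?|] [?|]; auto; left.
apply: (@le_trans _ _ (a + b)%:E).
  rewrite wassersteinE; apply: ge_ereal_inf.
  exists (gsum p G3 `^ p^-1)%E; first by exists G3.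
  have -> : (a + b)%:E = (((a + b) `^ p)%:E `^ p^-1)%E.
    by rewrite poweR_EFin -powRrM mulfV ?gt_eqF// powRr1// addr_ge0 ?ltW.
  have G0 : (0 <= gsum p G3)%E by apply: esum_ge0 => x _; rewrite lee_fin powR_ge0.
  apply: gt0_ler_poweR; rewrite ?in_itv/= ?leey ?andbT ?invr_ge0 ?(ltW p0)//.
  by rewrite lee_fin powR_ge0.
rewrite EFinD; apply: le_trans (leeD alt blt) _.
by rewrite addeACA -EFinD -splitr.
Qed.
End triangle.

Section basic.
Context {R : realType} (p : R).
Context (p_gt0 : 0 < p).
Implicit Types D : pdiagram R.

Lemma wasserstein_refl D : wasserstein p D D = 0%E.
Proof.
apply/eqP; rewrite eq_le wasserstein_ge0 andbT wassersteinE.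
apply: ge_ereal_inf; exists 0%E => //.
exists (fun e => if e.1 is Some i then e.2 = Some i else False).
  split=> [i|j|//]; first by exists (Some i); split => // b ->.
  by exists (Some j); split => // -[i [->]|[]].
rewrite /gsum esum1 ?poweR0r ?invr_eq0 ?gt_eqF//.
by move=> [[i|] b] //= ->; rewrite subrr normr0 powR0// gt_eqF.
Qed.

Lemma wasserstein_sym D1 D2 : wasserstein p D1 D2 = wasserstein p D2 D1.
Proof.
suff H D D' : (wasserstein p D D' <= wasserstein p D' D)%E.
  by apply/eqP; rewrite eq_le !H.
rewrite (wassersteinE _ D') wassersteinE; apply: le_ereal_inf_tmp => _ [G [G1 G2 G0] <-].
apply: ge_ereal_inf; exists (gsum p G `^ p^-1)%E => //.
exists (fun e => G (e.2, e.1)); first by split.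
congr poweR; rewrite /gsum.
rewrite (reindex_esum (fun e => G (e.2, e.1)) G (fun e => (e.2, e.1))).
  by apply: eq_esum => -[[i|] [j|]] _ //=; rewrite distrC.
split => //.
  by move=> [a b] [a' b'] _ _ [-> ->].
by move=> [a b] Gab; exists (b, a).
Qed.

End basic.

Section dgm.
Context {R : realType} (p : R) (p1 : 1 <= p).

Definition finite_pdiagram : Type :=
  {D : pdiagram R | (wasserstein p D (pd_empty R) < +oo)%E}.

HB.instance Definition _ := Choice.on finite_pdiagram.

Implicit Types D : finite_pdiagram.

Let p0 : 0 < p. Proof. exact: lt_le_trans p1. Qed.

Lemma wasserstein_fin_num D1 D2 : wasserstein p (val D1) (val D2) \is a fin_num.
Proof.
rewrite ge0_fin_numE ?wasserstein_ge0//.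
apply: le_lt_trans (wasserstein_triangle p1 _ (pd_empty R) _) _.
rewrite (wasserstein_sym _ (pd_empty R)) lte_add_pinfty//.
  exact: (svalP D1).
exact: (svalP D2).
Qed.

Definition dgm_eq D1 D2 : bool := wasserstein p (val D1) (val D2) == 0%E.

Let dgm_eq_refl : reflexive dgm_eq.
Proof. by move=> D; rewrite /dgm_eq wasserstein_refl. Qed.

Let dgm_eq_sym : symmetric dgm_eq.
Proof. by move=> D1 D2; rewrite /dgm_eq wasserstein_sym. Qed.

Let dgm_eq_trans : transitive dgm_eq.
Proof.
move=> D2 D1 D3 /eqP D12 /eqP D23; rewrite /dgm_eq eq_le wasserstein_ge0 andbT.
by rewrite (le_trans (wasserstein_triangle p1 _ (val D2) _))// D12 D23 adde0.
Qed.

Canonical dgm_eq_canonical :=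
  EquivRel dgm_eq dgm_eq_refl dgm_eq_sym dgm_eq_trans.

Local Open Scope quotient_scope.

Definition Dgm : Type := {eq_quot dgm_eq}.
HB.instance Definition _ := Choice.on Dgm.
HB.instance Definition _ := EqQuotient.on Dgm.

(* Independent of the representatives by [dgm_dist_pi]; this is the [mdist] of
   the [metricType] structure on [Dgm] declared below. *)
Definition dgm_dist (x y : Dgm) : R :=
  fine (wasserstein p (val (repr x)) (val (repr y))).

Lemma dgm_dist_pi D1 D2 :
  dgm_dist (\pi_Dgm D1) (\pi_Dgm D2) = fine (wasserstein p (val D1) (val D2)).
Proof.
have E D : wasserstein p (val (repr (\pi_Dgm D))) (val D) = 0%E.
  by apply/eqP; rewrite -[_ == _]/(dgm_eq _ _) -eqmodE reprK.
have E' D : wasserstein p (val D) (val (repr (\pi_Dgm D))) = 0%E.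
  by rewrite wasserstein_sym E.
congr fine; apply/eqP; rewrite eq_le; apply/andP; split.
  apply: le_trans (wasserstein_triangle p1 _ (val D1) _) _; rewrite E add0e.
  by apply: le_trans (wasserstein_triangle p1 _ (val D2) _) _; rewrite E' adde0.
apply: le_trans (wasserstein_triangle p1 _ (val (repr (\pi_Dgm D1))) _) _.
rewrite E' add0e.
apply: le_trans (wasserstein_triangle p1 _ (val (repr (\pi_Dgm D2))) _) _.
by rewrite E adde0.
Qed.

Let dgm_distxx x : dgm_dist x x = 0.
Proof. by rewrite /dgm_dist wasserstein_refl. Qed.

Let dgm_dist_positivity x y : dgm_dist x y = 0 -> x = y.
Proof.
move=> xy; rewrite -[x]reprK -[y]reprK; apply/eqmodP => /=; apply/eqP.
by rewrite -[LHS]fineK ?wasserstein_fin_num// [fine _]xy.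
Qed.

Let dgm_dist_sym x y : dgm_dist x y = dgm_dist y x.
Proof. by rewrite /dgm_dist wasserstein_sym. Qed.

Let dgm_dist_triangle y x z : dgm_dist x z <= dgm_dist x y + dgm_dist y z.
Proof.
rewrite -lee_fin EFinD !fineK ?wasserstein_fin_num//.
exact: wasserstein_triangle.
Qed.

HB.instance Definition _ := @isMetric.Build R Dgm
  dgm_dist dgm_distxx dgm_dist_positivity dgm_dist_sym dgm_dist_triangle.

End dgm.

(* [dX] and [dY] are the metrics of [X] and [Y]; only the values of the control
   functions on the nonnegative reals are constrained. *)
Definition coarse_embedding (R : realType) (X Y : Type)
    (dX : X -> X -> R) (dY : Y -> Y -> R) (f : X -> Y) : Prop :=
  exists rho1 rho2 : R -> R,
    [/\ forall t, 0 <= t -> 0 <= rho1 t /\ 0 <= rho2 t,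
        forall s t, 0 <= s -> s <= t -> rho1 s <= rho1 t /\ rho2 s <= rho2 t,
        forall x y, rho1 (dX x y) <= dY (f x) (f y) <= rho2 (dX x y) &
        rho1 t @[t --> +oo] --> +oo].

(* [theta] is the identity for a real Hilbert space and the conjugation for a
   complex one. *)
Definition is_hilbert (K : numFieldType) (theta : K -> K)
    (H : completeNormedModType K) : Prop :=
  exists dot : {dot H for theta}, forall x, `|x| ^+ 2 = dot x x.

(* Main.v *)
Require Import Defs.
From HB Require Import structures.
From mathcomp Require Import all_boot all_order all_algebra.
From mathcomp Require Import generic_quotient.
From mathcomp Require Import all_classical all_reals all_analysis.
From mathcomp Require Import complex ring lra zify.

(* A square loop of [4k] points gives a map from the cycle Z/4k to the plane that
   is 1-Lipschitz and moves antipodal points at least [k] apart. Taking one such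
   loop, scaled by [s], for each of [n = 4k^2] well-separated off-diagonal points
   gives a map from the torus (Z/4k)^n to diagrams for which a step in {0,1}^n
   costs at most [s n^(1/p)], whereas adding [2k] to one coordinate costs at least
   [s k]. In a Hilbert space, metric cotype 2 bounds the mean square of the
   [2k]-increments by a constant times that of the unit steps as soon as
   [n >= 4k^2]. With [s = n^(-1/p)] the steps stay bounded while
   [s k], of order [k^(1 - 2/p)], is unbounded because [p > 2]. *)

Import Order.TTheory GRing.Theory Num.Theory.
Import numFieldNormedType.Exports.

Local Open Scope classical_set_scope.
Local Open Scope ring_scope.

(** * Quadratic estimates for commuting isometries *)

Section commuting_isometries.
Context {R : realFieldType} {V : zmodType} (ip : V -> V -> R).
Context (ipC : forall u v, ip u v = ip v u).
Context (ipDl : forall u v w, ip (u + v) w = ip u w + ip v w).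
Context (ip_ge0 : forall u, 0 <= ip u u).

Local Notation N u := (ip u u).

Let ipBl u v w : ip (u - v) w = ip u w - ip v w.
Proof. by rewrite -{2}(subrK v u) ipDl addrK. Qed.

Let ipMnl u w n : ip (u *+ n) w = n%:R * ip u w.
Proof.
elim: n => [|n IH]; first by rewrite mulr0n mul0r -(subrr u) ipBl subrr.
by rewrite mulrS ipDl IH -natr1 mulrDl mul1r addrC.
Qed.

Let NB u v : N (u - v) = N u + N v - 2 * ip u v.
Proof. rewrite ipBl (ipC u) (ipC v (u - v)) !ipBl (ipC v u); ring. Qed.

Let ND u v : N (u + v) = N u + N v + 2 * ip u v.
Proof. rewrite ipDl (ipC u) (ipC v (u + v)) !ipDl (ipC v u); ring. Qed.

Context {J : eqType} (T : J -> {additive V -> V}).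
Context (T_comm : forall i j u, T i (T j u) = T j (T i u)).
Context (T_isom : forall j u, N (T j u) = N u).

Fixpoint prodT (s : seq J) (u : V) : V :=
  if s is j :: s' then T j (prodT s' u) else u.

(** The product of the operators [T j + 1]. Expanded, it is the sum of [prodT s' u] over the
    [2 ^ size s] subsequences [s'], selected by position. *)
Fixpoint prodT1 (s : seq J) (u : V) : V :=
  if s is j :: s' then T j (prodT1 s' u) + prodT1 s' u else u.

Let prodTT s j u : prodT s (T j u) = T j (prodT s u).
Proof. by elim: s => //= i s ->. Qed.

Let prodT1T s j u : prodT1 s (T j u) = T j (prodT1 s u).
Proof. by elim: s => //= i s ->; rewrite T_comm raddfD. Qed.

Let prodT1D s u v : prodT1 s (u + v) = prodT1 s u + prodT1 s v.
Proof. by elim: s => //= i s ->; rewrite raddfD /= addrACA. Qed.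

Let prodT1B s u v : prodT1 s (u - v) = prodT1 s u - prodT1 s v.
Proof. by rewrite -{2}(subrK v u) prodT1D addrK. Qed.

Let prodT1_iter s j m u : prodT1 s (iter m (T j) u) = iter m (T j) (prodT1 s u).
Proof. by elim: m => //= m <-; rewrite prodT1T. Qed.

Let iter_isom j m u : N (iter m (T j) u) = N u.
Proof. by elim: m => //= m <-. Qed.

Let parallelogram j u : N (T j u + u) + N (T j u - u) = 4 * N u.
Proof. rewrite ND NB T_isom; ring. Qed.

Let iterB_le j m u : N (iter m (T j) u - u) <= m%:R ^+ 2 * N (T j u - u).
Proof.
elim: m => [|m IH]; first by rewrite /= subrr -{1}(subrr u) ipBl subrr expr0n mul0r.
have [->|m0] := posnP m; first by rewrite expr1n mul1r.
set a := iter m _ _ in IH *; set d := T j u - u in IH *.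
have -> : iter m.+1 (T j) u - u = T j (a - u) + d.
  by rewrite /d raddfB /= addrA subrK.
rewrite ND T_isom.
(* The triangle inequality without square roots: with [x], [y], [z] as named below, this square
   gives [2 z <= x / m + m y], the weights for which [x <= m^2 y] yields exactly [(m + 1)^2 y]. *)
have := ip_ge0 (T j (a - u) - d *+ m).
rewrite NB T_isom ipMnl (ipC (T j _)) ipMnl (ipC d (d *+ m)) ipMnl (ipC d (T j _)).
move: IH (ip_ge0 d); set x := N (a - u); set y := N d; set z := ip _ d => IH y0 H.
have m0R : 0 < m%:R :> R by rewrite ltr0n.
rewrite -natr1 -(ler_pM2l m0R); nra.
Qed.

Let prodT1_le s u : N (prodT1 s u) <= 4 ^+ size s * N u.
Proof.
elim: s => [|j s IH] /=; first by rewrite expr0 mul1r.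
have := parallelogram j (prodT1 s u); have := ip_ge0 (T j (prodT1 s u) - prodT1 s u).
rewrite exprS; lra.
Qed.

(** The squared norm that [prodT1 s] loses against its largest possible value. By [prodT1_le] it is
    a nonnegative quadratic form. *)
Let defect s u := 4 ^+ size s * N u - N (prodT1 s u).

(** With [w = prodT1 s u], the parallelogram law says that adding the factor [T j + 1] turns the
    defect into four times itself plus [N (T j w - w)]. The new summand is at most
    [4 * N (T j w - w)], and the old ones grow by at most a factor 4. *)
Let sum_defect s u :
  \sum_(j <- s) N (prodT1 s (T j u - u)) <= 4 * defect s u.
Proof.
elim: s => [|j s IH]; first by rewrite big_nil /defect expr0 mul1r subrr mulr0.
have P i w : N (prodT1 (i :: s) w) <= 4 * N (prodT1 s w).
  by have := prodT1_le [:: i] (prodT1 s w); rewrite /= expr1.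
rewrite big_cons /defect /= exprS.
have := parallelogram j (prodT1 s u).
have H : \sum_(i <- s) N (prodT1 (j :: s) (T i u - u)) <=
    4 * \sum_(i <- s) N (prodT1 s (T i u - u)).
  by rewrite mulr_sumr; apply: ler_sum => i _; exact: P.
have := P j (T j u - u); rewrite [in X in _ <= X]prodT1B prodT1T /=.
move: H IH; rewrite /defect /=; lra.
Qed.

Let defectB s u v : defect s (u - v) <= 2 * defect s u + 2 * defect s v.
Proof.
have := prodT1_le s (u + v); rewrite /defect prodT1B prodT1D !NB !ND; lra.
Qed.

(** Every term of the expanded product is close to [u], so the sum has a large inner product with
    [u]; expanding the square of [2 ^ size s] times [u] minus the sum then bounds its norm from
    below. *)
Let defect_le s u K :
    (forall s', subseq s' s -> N (prodT s' u - u) <= K) ->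
  defect s u <= 4 ^+ size s * K.
Proof.
move=> uK.
(* The vector [w] is generalized because removing the head [j] leaves the shorter product applied to
   both [w] and [T j w]. *)
have H : forall w, (forall s', subseq s' s -> 2 * N u - K <= 2 * ip u (prodT s' w)) ->
    2 ^+ size s * (2 * N u - K) <= 2 * ip u (prodT1 s w).
  elim: s {uK} => [|j s IH] w /= wK; first by rewrite expr0 mul1r (wK [::]).
  have H1 : 2 ^+ size s * (2 * N u - K) <= 2 * ip u (prodT1 s (T j w)).
    by apply: IH => s' s's; rewrite prodTT; apply: (wK (j :: s')); rewrite /= eqxx.
  have H2 : 2 ^+ size s * (2 * N u - K) <= 2 * ip u (prodT1 s w).
    by apply: IH => s' s's; apply: wK; apply: subseq_trans s's (subseq_cons _ _).
  rewrite -prodT1T (ipC u) ipDl !(ipC _ u) exprS -mulrA; lra.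
have prodN s' : N (prodT s' u) = N u by elim: s' => //= j s' IH; rewrite T_isom.
have {}H := H u _; have {}H : 2 ^+ size s * (2 * N u - K) <= 2 * ip u (prodT1 s u).
  by apply: H => s' /uK; rewrite NB prodN (ipC _ u); lra.
have := ip_ge0 (u *+ 2 ^ size s - prodT1 s u).
rewrite NB !ipMnl (ipC u (_ *+ _)) ipMnl natrX /defect.
have e : 0 <= 2 ^+ size s :> R by rewrite exprn_ge0.
have -> : 4 ^+ size s = 2 ^+ size s * 2 ^+ size s :> R by rewrite -exprMn -natrM.
move: (2 ^+ size s) e H => c e /(ler_wpM2l e); nra.
Qed.

(* Metric cotype 2. Since [prod_j (T j + 1)] nearly preserves [u], up to the
   defect above, it suffices to bound the increments of its image. *)
Lemma isometries_cotype2 s u K m :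
    (forall s', subseq s' s -> N (prodT s' u - u) <= K) ->
  \sum_(j <- s) N (iter m (T j) u - u) <= 4 * (m%:R ^+ 2 + (size s)%:R) * K.
Proof.
move=> uK; have := defect_le _ _ _ uK; have := sum_defect s u.
set c := 4 ^+ size s => S D.
have c0 : 0 < c by rewrite exprn_gt0.
(* For [v = iter m (T j) u - u], [c * N v] is [N (prodT1 s v)] plus the defect of [v]. The first is
   bounded by [iterB_le] at [prodT1 s u], the second by [defectB], as [T j] preserves the defect. *)
have H j : c * N (iter m (T j) u - u) <=
    m%:R ^+ 2 * N (prodT1 s (T j u - u)) + 4 * defect s u.
  have := defectB s (iter m (T j) u) u; rewrite {1 2}/defect.
  have := iterB_le j m (prodT1 s u).
  rewrite !prodT1B prodT1T prodT1_iter !iter_isom -/c /defect -/c; lra.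
rewrite -(ler_pM2l c0) mulr_sumr.
apply: (@le_trans _ _ (\sum_(j <- s)
   (m%:R ^+ 2 * N (prodT1 s (T j u - u)) + 4 * defect s u))).
  by apply: ler_sum => j _; exact: H.
have sumc (x : R) : \sum_(j <- s) x = (size s)%:R * x.
  by rewrite big_const_seq count_predT iter_addr addr0 mulr_natl.
rewrite big_split /= -mulr_sumr sumc.
apply: (@le_trans _ _ (m%:R ^+ 2 * (4 * defect s u) + (size s)%:R * (4 * defect s u))).
  by rewrite lerD2r ler_wpM2l// exprn_ge0.
have : (m%:R ^+ 2 + (size s)%:R) * defect s u <= (m%:R ^+ 2 + (size s)%:R) * (c * K).
  by rewrite ler_wpM2l// addr_ge0// exprn_ge0.
lra.
Qed.

End commuting_isometries.

(** * Metric cotype 2 for maps on a finite abelian group *)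

Section translations.
Context {G : finZmodType} {H : zmodType}.

Definition translate (a : G) (f : {ffun G -> H}) : {ffun G -> H} :=
  [ffun x => f (x + a)].

Let translate_is_zmod_morphism a : zmod_morphism (translate a).
Proof. by move=> f g; apply/ffunP => x; rewrite !ffunE. Qed.

HB.instance Definition _ a := GRing.isZmodMorphism.Build _ _ (translate a)
  (translate_is_zmod_morphism a).

Context {R : realFieldType} (ip : H -> H -> R).
Context (ipC : forall u v, ip u v = ip v u).
Context (ipDl : forall u v w, ip (u + v) w = ip u w + ip v w).
Context (ip_ge0 : forall u, 0 <= ip u u).

(** Translations by the [e i] are commuting isometries of the functions [G -> H] for the inner
    product summed over [G]. Subsequences of [enum J] have no repetitions and so correspond to the
    sets [A]. *)
Lemma group_cotype2 {J : finType} (e : J -> G) (f : G -> H) K m :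
    (forall x (A : {set J}),
       ip (f (x + \sum_(i in A) e i) - f x) (f (x + \sum_(i in A) e i) - f x) <= K) ->
  \sum_i \sum_x ip (f (x + e i *+ m) - f x) (f (x + e i *+ m) - f x) <=
    4 * (m%:R ^+ 2 + #|J|%:R) * (#|G|%:R * K).
Proof.
move=> fK; pose IP (g h : {ffun G -> H}) := \sum_x ip (g x) (h x).
pose T i : {additive {ffun G -> H} -> {ffun G -> H}} := translate (e i).
have prodE s g x : prodT T s g x = g (x + \sum_(i <- s) e i).
  elim: s x => [|i s IH] x /=; first by rewrite big_nil addr0.
  by rewrite ffunE IH big_cons addrA.
have iterE i g x : iter m (T i) g x = g (x + e i *+ m).
  elim: m x {fK} => [|k IH] x /=; first by rewrite mulr0n addr0.
  by rewrite ffunE IH mulrS addrA.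
have := @isometries_cotype2 R _ IP _ _ _ J T _ _ (enum J) (finfun f) (#|G|%:R * K) m.
rewrite -cardE cardT -cardE big_enum /= => le.
apply: le_trans (le _ _ _ _ _ _) => {le}.
- apply: ler_sum => i _; apply: ler_sum => x _.
  by rewrite !ffunE iterE ffunE.
- by move=> g h; apply: eq_bigr => x _.
- by move=> g h l; rewrite /IP -big_split; apply: eq_bigr => x _; rewrite ffunE.
- by move=> g; apply: sumr_ge0 => x _.
- by move=> i j g; apply/ffunP => x; rewrite !ffunE addrAC.
- move=> i g; rewrite /IP [RHS](reindex_inj (addIr (e i))).
  by apply: eq_bigr => x _; rewrite !ffunE.
move=> s /subseq_uniq /(_ (enum_uniq _)) us.
apply: (@le_trans _ _ (\sum_(x : G) K)); last by rewrite sumr_const mulr_natl.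
apply: ler_sum => x _; rewrite !ffunE prodE ffunE.
have -> : \sum_(i <- s) e i = \sum_(i in [set i in s]%SET) e i.
  by rewrite big_uniq //; apply: eq_bigl => i; rewrite inE.
exact: fK.
Qed.

End translations.

(** * Wasserstein bounds for finite diagrams *)

Section wasserstein_bounds.
Context {R : realType} (p : R).
Context (p0 : 0 < p).

Lemma esum_ord n (g : 'I_n -> R) : (forall i, 0 <= g i) ->
  (\esum_(i in [set: 'I_n]) (g i)%:E = (\sum_i g i)%:E)%E.
Proof.
move=> g0; rewrite esum_fset//; last by move=> i _; rewrite lee_fin.
rewrite -sumEFin -big_enum (fsbig_seq _ _ (enum_uniq _)); apply: eq_fsbigl.
- by apply/seteqP; split => i //= _; rewrite mem_enum.
- exact: finite_finset.
Qed.

(* The index type ['I_n] lives in too large a universe for [pd_index]. *)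
Definition index_of {n} (i : 'I_n) : {i : nat | (i < n)%N} := exist _ (val i) (ltn_ord i).

Let index_ofK n (i : {i : nat | (i < n)%N}) : index_of (Ordinal (svalP i)) = i.
Proof. exact: val_inj. Qed.

Let countable_index n : countable [set: {i : nat | (i < n)%N}].
Proof. by apply/countable_injP; exists sval => i j _ _; exact: val_inj. Qed.

Definition finite_diagram {n} (P : 'I_n -> R * R) (Plt : forall i, (P i).1 < (P i).2) :
  pdiagram R := @PDiagram R {i : nat | (i < n)%N}
    (fun i => P (Ordinal (svalP i))) (countable_index n) (fun i => Plt _).

Let finite_diagramE n (P : 'I_n -> R * R) Plt i :
  finite_diagram P Plt (index_of i) = P i.
Proof. by congr P; exact: val_inj. Qed.

Lemma finite_diagram_finite n (P : 'I_n -> R * R) Plt :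
  (wasserstein p (finite_diagram P Plt) (pd_empty R) < +oo)%E.
Proof.
set D := finite_diagram P _.
rewrite wassersteinE; apply: (@le_lt_trans _ _
   (gsum p [set (Some (index_of i : pd_index D), None : option (pd_index (pd_empty R)))
     | i in [set: 'I_n]] `^ p^-1)%E).
  apply: ge_ereal_inf; eexists; last exact: lexx.
  eexists; last by [].
  split.
  - move=> i; exists None; split; last by move=> [[]|].
    by exists (Ordinal (svalP i)); rewrite ?index_ofK.
  - by case.
  - by move=> [].
rewrite /gsum esum_image; last by move=> i j _ _ [] /val_inj.
by rewrite esum_ord ?poweR_EFin ?ltry// => i; exact: powR_ge0.
Qed.

(** Matching points of equal index costs at most [n * s ^ p] before the root is taken. *)
Lemma wasserstein_le1 n (P Q : 'I_n -> R * R) Plt Qlt (s : R) :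
    (forall i, `|P i - Q i| <= s) -> n%:R * s `^ p <= 1 ->
  (wasserstein p (finite_diagram P Plt) (finite_diagram Q Qlt) <= 1)%E.
Proof.
set D := finite_diagram P _; set D' := finite_diagram Q _ => PQ ns.
rewrite wassersteinE; apply: (@le_trans _ _
   (gsum p [set (Some (index_of i : pd_index D), Some (index_of i : pd_index D'))
     | i in [set: 'I_n]] `^ p^-1)%E).
  apply: ge_ereal_inf; eexists; last exact: lexx.
  eexists; last by [].
  split.
  - move=> i; exists (Some i); split.
      by exists (Ordinal (svalP i)); rewrite ?index_ofK.
    by move=> b [j _ [<- <-]].
  - move=> i; exists (Some i); split.
      by exists (Ordinal (svalP i)); rewrite ?index_ofK.
    by move=> b [j _ [<- <-]].
  - by move=> [].
rewrite /gsum esum_image; last by move=> i j _ _ [] /val_inj.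
rewrite esum_ord ?poweR_EFin => [|i]; last exact: powR_ge0.
have -> : 1%E = ((1 : R) `^ p^-1)%:E by rewrite powR1.
rewrite lee_fin ge0_ler_powR ?invr_ge0 ?(ltW p0) ?nnegrE ?sumr_ge0//.
  by move=> i _; exact: powR_ge0.
apply: le_trans ns; rewrite mulr_natl -[X in _ *+ X]card_ord -sumr_const.
apply: ler_sum => i _; rewrite /odist !finite_diagramE ge0_ler_powR ?(ltW p0) ?nnegrE//.
exact: le_trans (PQ i).
Qed.

(** Whether a matching pairs [i] with a point or leaves it to the diagonal, this one term already
    contributes [c ^ p]. *)
Lemma wasserstein_ge (D1 D2 : pdiagram R) (i : pd_index D1) (c : R) :
    0 <= c -> c <= pers i -> (forall j, c <= `|D1 i - D2 j|) ->
  (c%:E <= wasserstein p D1 D2)%E.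
Proof.
move=> c0 ci cj; rewrite wassersteinE; apply: le_ereal_inf_tmp => _ [G [G1 _ _] <-].
have [b [Gib _]] := G1 i.
have cb : c <= odist (Some i, b) by case: b {Gib} => [j|] /=.
have -> : c%:E = (((c `^ p)%:E) `^ p^-1)%E.
  by rewrite poweR_EFin -powRrM mulfV ?gt_eqF// powRr1.
apply: gt0_ler_poweR; rewrite ?in_itv/= ?leey ?andbT ?invr_ge0 ?(ltW p0)//.
- by rewrite lee_fin powR_ge0.
- by apply: esum_ge0 => x _; rewrite lee_fin powR_ge0.
apply: esum_ge; exists [set (Some i, b)].
  by split => // _ ->.
rewrite fsbig_set1 lee_fin ge0_ler_powR ?(ltW p0) ?nnegrE//.
exact: le_trans cb.
Qed.

Lemma finite_wasserstein_ge n (P Q : 'I_n -> R * R) Plt Qlt i (c : R) :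
    0 <= c -> 2 * c <= (P i).2 - (P i).1 -> (forall j, c <= `|P i - Q j|) ->
  (c%:E <= wasserstein p (finite_diagram P Plt) (finite_diagram Q Qlt))%E.
Proof.
move=> c0 ci cj; apply: (wasserstein_ge (finite_diagram P Plt) (finite_diagram Q Qlt)
  (index_of i)) => //.
  by rewrite /pers finite_diagramE; lra.
by move=> j; rewrite finite_diagramE; exact: cj.
Qed.

End wasserstein_bounds.

(** * Square loops over the cycle Z/4k *)

(* With truncated subtraction, this is the absolute value of [a - 2k]. *)
Definition tent (k a : nat) := ((2 * k - a) + (a - 2 * k))%N.

Lemma modn_lt2 k a : (a < 8 * k)%N ->
  (a %% (4 * k) = if a < 4 * k then a else a - 4 * k)%N.
Proof.
move=> a8; case: ifP => a4; first exact: modn_small.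
rewrite -{1}(subnK (n:=a) (m:=4 * k)); last by lia.
by rewrite modnDr modn_small//; lia.
Qed.

(** Passing from [4k - 1] to [0] is harmless because the absolute value of [a - 2k] agrees at [0]
    and [4k]. *)
Lemma tent_lipschitz k a e : (0 < k)%N -> (a < 4 * k)%N -> (e <= 1)%N ->
  (tent k ((a + e) %% (4 * k)) <= (tent k a).+1 /\
   tent k a <= (tent k ((a + e) %% (4 * k))).+1)%N.
Proof.
by move=> k0 ak e1; rewrite modn_lt2; [rewrite /tent; case: ifP; lia|lia].
Qed.

(** The two coordinates of the loop are [tent] and its shift by a quarter turn. If a half turn moves
    one of them by less than [k], it moves the other by at least [k]. *)
Lemma tent_half_turn k a : (0 < k)%N -> (a < 4 * k)%N ->
  let b := ((a + 2 * k) %% (4 * k))%N in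
  let a' := ((a + k) %% (4 * k))%N in
  let b' := ((b + k) %% (4 * k))%N in
  [\/ tent k a + k <= tent k b, tent k b + k <= tent k a,
      tent k a' + k <= tent k b' | tent k b' + k <= tent k a']%N.
Proof.
move=> k0 ak /=; rewrite modnDml !modn_lt2; [|lia..].
rewrite /tent; do 3?case: ifP => ?.
(* A half turn changes [tent k a] by exactly [k] when [2a] is [k], [3k], [5k] or [7k]. *)
all: have [?|?] := leqP (2 * a) k; have [?|?] := leqP (3 * k) (2 * a);
  have [?|?] := leqP (2 * a) (5 * k); have [?|?] := leqP (7 * k) (2 * a).
all: first [lia | by apply: Or41; lia | by apply: Or42; lia
            | by apply: Or43; lia | by apply: Or44; lia].
Qed.

(** * The map from the torus to diagrams *)

Section torus.
Context {R : realType} (k n : nat) (k0 : (0 < k)%N) (s : R) (s0 : 0 < s).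

(* As [tent] takes values in [0, 2k], the spacing [3k] keeps points of distinct
   loops [k] apart, and the offset [4k] keeps all of them [k] away from the
   diagonal. *)
Definition loop_fst (j a : nat) := (3 * k * j + tent k a)%N.
Definition loop_snd (j a : nat) := (3 * k * j + 4 * k + tent k ((a + k) %% (4 * k)))%N.

Definition torus_point (x : 'rV['Z_(4 * k)]_n) (j : 'I_n) : R * R :=
  (s * (loop_fst j (x 0 j))%:R, s * (loop_snd j (x 0 j))%:R).

Let ltZ (a : 'Z_(4 * k)) : (a < 4 * k)%N.
Proof. by rewrite -[X in (_ < X)%N]Zp_cast ?ltn_ord//; lia. Qed.

Let valZD (a b : 'Z_(4 * k)) : (a + b)%R = ((a + b) %% (4 * k))%N :> nat.
Proof. by congr (_ %% _)%N; apply: Zp_cast; lia. Qed.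

Let valZnat m : (m%:R : 'Z_(4 * k)) = (m %% (4 * k))%N :> nat.
Proof. by rewrite val_Zp_nat//; lia. Qed.

Let tent_le a : (a < 4 * k)%N -> (tent k a <= 2 * k)%N.
Proof. by rewrite /tent; lia. Qed.

Let loop_gap j a : (a < 4 * k)%N -> (loop_fst j a + 2 * k <= loop_snd j a)%N.
Proof. by move=> /tent_le; rewrite /loop_fst /loop_snd; lia. Qed.

Lemma torus_point_gap x j :
  2 * (s * k%:R) <= (torus_point x j).2 - (torus_point x j).1.
Proof.
have := loop_gap j _ (ltZ (x 0 j)); rewrite -(ler_nat R) natrD natrM /= => h.
by move: (ler_wpM2l (ltW s0) h); lra.
Qed.

Lemma torus_point_lt x j : (torus_point x j).1 < (torus_point x j).2.
Proof.
have := torus_point_gap x j; have : 0 < s * k%:R by rewrite mulr_gt0// ltr0n.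
lra.
Qed.

(** Points of different loops are separated by the spacing of the first coordinates, whatever their
    positions; on a common loop [tent_half_turn] applies. *)
Lemma torus_point_far (x y : 'rV['Z_(4 * k)]_n) i j :
    (i = j -> y 0 i = x 0 i + (2 * k)%:R) ->
  s * k%:R <= `|torus_point x i - torus_point y j|.
Proof.
move=> xy.
have far (a b : nat) : (a + k <= b \/ b + k <= a)%N ->
    s * k%:R <= `|s * a%:R - s * b%:R|.
  move=> ab; rewrite -mulrBr normrM (gtr0_norm s0) ler_pM2l// ler_normr.
  by case: ab; rewrite -(ler_nat R) natrD => ab; apply/orP; [right|left]; lra.
rewrite prod_normE /= le_max; apply/orP.
have [ij|/eqP ij] := eqVneq i j; last first.
  left; apply: far; have := tent_le _ (ltZ (x 0 i)); have := tent_le _ (ltZ (y 0 j)).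
  have : (i < j)%N \/ (j < i)%N by apply/orP; rewrite -neq_ltn; apply/eqP => /val_inj.
  rewrite /loop_fst; nia.
move: ij xy => <- /(_ erefl) ->.
rewrite valZD valZnat modnDmr.
have := tent_half_turn _ _ k0 (ltZ (x 0 i)); rewrite /loop_fst /loop_snd.
by case=> h; [left|left|right|right]; apply: far; lia.
Qed.

Lemma torus_point_near (x y : 'rV['Z_(4 * k)]_n) i (e : bool) : y 0 i = x 0 i + e%:R ->
  `|torus_point x i - torus_point y i| <= s.
Proof.
move=> yx.
have near (a b : nat) : (a <= b.+1 /\ b <= a.+1)%N -> `|s * a%:R - s * b%:R| <= s.
  move=> ab; rewrite -mulrBr normrM (gtr0_norm s0) -[leRHS]mulr1 ler_pM2l// ler_norml.
  by case: ab; rewrite -!(ler_nat R) -!natr1; lra.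
have e1 : (e <= 1)%N by exact: leq_b1.
rewrite prod_normE /= ge_max yx valZD valZnat modnDmr.
apply/andP; split; apply: near.
  by have := tent_lipschitz _ _ _ k0 (ltZ (x 0 i)) e1; rewrite /loop_fst; lia.
have ltm : ((x 0%R i + k) %% (4 * k) < 4 * k)%N by rewrite ltn_mod; lia.
have := tent_lipschitz _ _ _ k0 ltm e1; rewrite /loop_snd !modnDml addnAC; lia.
Qed.

End torus.

(** The left side equals [4 * T ^ p / k ^ (p - 2)], which tends to 0 because [p > 2]; the threshold
    [c] solves [c ^ (p - 2) = 4 * T ^ p]. *)
Lemma scale_exists {R : realType} (p T : R) : 2 < p -> 0 < T ->
  exists2 k, (0 < k)%N & (4 * k ^ 2)%N%:R * (T / k%:R) `^ p <= 1.
Proof.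
move=> p2 T0; have p20 : 0 < p - 2 by lra.
pose c := (4 * T `^ p) `^ (p - 2)^-1.
have c0 : 0 < c by rewrite powR_gt0// mulr_gt0// powR_gt0.
pose k := Num.bound c.
have ck : c < k%:R by exact: archi_boundP (ltW c0).
have k0 : 0 < k%:R :> R by exact: lt_trans ck.
exists k; first by rewrite -(ltr0n R).
have kp : k%:R `^ p = k%:R `^ (p - 2) * k%:R ^+ 2.
  by rewrite -powR_mulrn ?(ltW k0)// -powRD ?subrK// (gt_eqF k0) implybT.
have ckp : 4 * T `^ p <= k%:R `^ (p - 2).
  have -> : 4 * T `^ p = c `^ (p - 2).
    by rewrite -powRrM mulVf ?gt_eqF// powRr1// mulr_ge0// powR_ge0.
  by rewrite ge0_ler_powR ?nnegrE ?(ltW p20) ?(ltW c0) ?(ltW k0)// ltW.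
have -> : (T / k%:R) `^ p = T `^ p / k%:R `^ p.
  by rewrite powRM ?invr_ge0 ?(ltW T0) ?(ltW k0)// -powR_inv1 ?(ltW k0)//
     -powRrM mulN1r powRN.
rewrite mulrA ler_pdivrMr ?powR_gt0// mul1r kp natrM natrX.
by rewrite mulrAC ler_wpM2r// exprn_ge0// ltW.
Qed.

(** * Boundedness of the lower control function *)

Section nonembedding.
Context {R : realType} (p : R) (p1 : 1 <= p) (hp : 2 < p).
Context {H : zmodType} (ip : H -> H -> R).
Context (ipC : forall u v, ip u v = ip v u).
Context (ipDl : forall u v w, ip (u + v) w = ip u w + ip v w).
Context (ip_ge0 : forall u, 0 <= ip u u).

Let p0 : 0 < p. Proof. exact: lt_le_trans p1. Qed.

Local Notation dist := (@mdist R (Dgm p1)).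

(** The torus is scaled so that unit steps cost at most 1 and half turns at least [T]. Metric cotype
    2 then compares the two control functions with a constant independent of [T]. *)
Lemma lower_control_le (f : Dgm p1 -> H) (rho1 rho2 : R -> R) (T : R) :
    (forall t : R, 0 <= t -> 0 <= rho1 t) ->
    (forall t : R, 0 <= t -> 0 <= rho2 t) ->
    (forall s t : R, 0 <= s -> s <= t -> rho1 s <= rho1 t /\ rho2 s <= rho2 t) ->
    (forall x y, rho1 (dist x y) ^+ 2 <= ip (f x - f y) (f x - f y)
                   <= rho2 (dist x y) ^+ 2) ->
  0 < T -> rho1 T ^+ 2 <= 8 * rho2 1 ^+ 2.
Proof.
move=> rho1_ge0 rho2_ge0 mono fP T0.
(* With [n = (2k)^2] the two terms of the cotype factor [4 * (m^2 + n)] at [m = 2k] coincide, whence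
   the constant 8 after division by [n]. *)
have [k k0 ks] := scale_exists p T hp T0; pose n := (4 * k ^ 2)%N.
pose s := T / k%:R; have kR : 0 < k%:R :> R by rewrite ltr0n.
have s0 : 0 < s by rewrite divr_gt0.
have sT : s * k%:R = T by rewrite divfK// gt_eqF.
pose G := 'rV['Z_(4 * k)]_n.
pose D (x : G) : finite_pdiagram p :=
  exist (fun D => is_true (wasserstein p D (pd_empty R) < +oo)%E) _
    (finite_diagram_finite p _ (torus_point k n s x)
      (torus_point_lt k n k0 s s0 x)).
pose g (x : G) : Dgm p1 := (\pi_(Dgm p1) (D x))%qT.
have gE x y : (dist (g x) (g y))%:E = wasserstein p (val (D x)) (val (D y)).
  by rewrite [dist _ _]dgm_dist_pi fineK// wasserstein_fin_num.
have near (x y : G) : (forall i, exists e : bool, y 0 i = x 0 i + e%:R) ->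
    dist (g x) (g y) <= 1.
  move=> xy; rewrite -lee_fin gE; apply: (wasserstein_le1 _ p0 _ _ _ _ _ s) => // i.
  by have [e] := xy i; apply: torus_point_near.
have far (x y : G) i : y 0 i = x 0 i + (2 * k)%:R -> T <= dist (g x) (g y).
  move=> xy; rewrite -lee_fin gE; apply: (@finite_wasserstein_ge R p p0 n
    (torus_point k n s x) (torus_point k n s y)
    (torus_point_lt k n k0 s s0 x) (torus_point_lt k n k0 s s0 y) i T).
  - exact: ltW.
  - by rewrite -sT; exact: torus_point_gap.
  - by move=> j; rewrite -sT; apply: torus_point_far => // <-.
have d0 x y : 0 <= dist x y by exact: mdist_ge0.
have := @group_cotype2 G H R ip ipC ipDl ip_ge0 'I_n (fun i => delta_mx 0 i)
  (f \o g) (rho2 1 ^+ 2) (2 * k) _.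
have K (x : G) (A : {set 'I_n}) :
    ip ((f \o g) (x + \sum_(i in A) delta_mx 0 i) - (f \o g) x)
       ((f \o g) (x + \sum_(i in A) delta_mx 0 i) - (f \o g) x) <= rho2 1 ^+ 2.
  set y := x + _; have /andP[_] := fP (g y) (g x); move=> /le_trans; apply.
  have yx : dist (g y) (g x) <= 1.
    rewrite metric_sym; apply: near => i; exists (i \in A).
    rewrite /y !mxE summxE; congr (_ + _).
    have [iA|/negP iA] := boolP (i \in A).
      rewrite (bigD1 i)//= mxE !eqxx big1 ?addr0// => j /andP[_ /negPf ji].
      by rewrite mxE eq_sym ji andbF.
    rewrite big1// => j jA; rewrite mxE; case: (eqVneq i j) => [ij|].
      by case: iA; rewrite ij.
    by rewrite andbF.
  by rewrite lerXn2r ?nnegrE ?rho2_ge0//; have [] := mono _ _ (d0 (g y) (g x)) yx.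
move=> /(_ K) le.
have G0 : 0 < #|G|%:R :> R by rewrite ltr0n; apply/card_gt0P; exists 0.
have n0 : 0 < n%:R :> R by rewrite ltr0n /n; lia.
have : n%:R * (#|G|%:R * rho1 T ^+ 2) <=
    4 * ((2 * k)%:R ^+ 2 + #|'I_n|%:R) * (#|G|%:R * rho2 1 ^+ 2).
  apply: le_trans le.
  rewrite mulr_natl -[X in _ *+ X]card_ord -sumr_const; apply: ler_sum => i _.
  rewrite mulr_natl -sumr_const; apply: ler_sum => x _.
  set y := x + _; have /andP[+ _] := fP (g y) (g x); apply: le_trans.
  have yx : T <= dist (g y) (g x).
    rewrite metric_sym; apply: (far _ _ i).
    by rewrite /y mxE mulmxnE mxE !eqxx.
  by rewrite lerXn2r ?nnegrE ?rho1_ge0 ?(ltW T0)//; have [] := mono _ _ (ltW T0) yx.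
have -> : (2 * k)%:R ^+ 2 = n%:R :> R by rewrite -natrX; congr (_%:R); rewrite /n; lia.
rewrite card_ord.
have -> : n%:R * (#|G|%:R * rho1 T ^+ 2) = n%:R * #|G|%:R * rho1 T ^+ 2 by ring.
have -> : 4 * (n%:R + n%:R) * (#|G|%:R * rho2 1 ^+ 2) =
    n%:R * #|G|%:R * (8 * rho2 1 ^+ 2) by ring.
by rewrite ler_pM2l// mulr_gt0.
Qed.

(** The form [ip] is only biadditive, so that real inner products and real parts of complex ones are
    treated alike. *)
Lemma no_coarse_embedding (d : H -> H -> R) :
    (forall u v, 0 <= d u v) -> (forall u v, d u v ^+ 2 = ip (u - v) (u - v)) ->
  ~ exists f : Dgm p1 -> H, coarse_embedding dist d f.
Proof.
move=> d0 dip [f [rho1 [rho2 [rho0 mono fP /cvgryPge rhoy]]]].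
pose c := 8 * rho2 1 ^+ 2.
have c0 : 0 <= c by rewrite mulr_ge0// sqr_ge0.
(* Since [c >= 0], the square of [c + 1] exceeds [c], against [lower_control_le]. *)
have [T [T0 cT]] : exists T, 0 < T /\ c + 1 <= rho1 T.
  have /filter_ex[T [T0 cT]] : \forall T \near +oo, 0 < T /\ c + 1 <= rho1 T.
    by near=> T; split; near: T; [exact: nbhs_pinfty_gt | exact: rhoy].
  by exists T.
have : rho1 T ^+ 2 <= c.
  apply: (lower_control_le f rho1 rho2 T) => // [t /rho0[]//|t /rho0[]//|x y].
  have mxy : 0 <= dist x y by exact: mdist_ge0.
  have /andP[lo up] := fP x y; have [r1 r2] := rho0 _ mxy.
  by rewrite -dip !lerXn2r ?nnegrE.
by rewrite expr2; nra.
Unshelve. all: by end_near.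
Qed.

End nonembedding.

Theorem theorem10 (R : realType) (p : R) (p1 : 1 <= p) (hp : 2 < p) :
  (forall H : completeNormedModType R, is_hilbert idfun H ->
     ~ exists f : Dgm p1 -> H,
         coarse_embedding (@mdist R (Dgm p1)) (fun x y => `|x - y|) f) /\
  (forall H : completeNormedModType R[i], is_hilbert Num.conj H ->
     ~ exists f : Dgm p1 -> H,
         coarse_embedding (@mdist R (Dgm p1)) (fun x y => complex.Re `|x - y|) f).
Proof.
split=> H [dot dotE].
  have dot_ge0 u : 0 <= dot u u by rewrite -dotE sqr_ge0.
  apply: (@no_coarse_embedding R p p1 hp H dot _ _ dot_ge0 (fun x y => `|x - y|)) => //.
  - by move=> u v; rewrite hermC expr0 mul1r.
  - by move=> u v w; rewrite linearDl.
(* In the complex case the real part of the Hermitian form is symmetric and biadditive, and it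
   induces the same norm. *)
have ReD (a b : R[i]) : complex.Re (a + b) = complex.Re a + complex.Re b.
  by case: a b => [? ?] [? ?].
have conjRe (a : R[i]) : complex.Re (Num.conj a) = complex.Re a by case: a.
have normE (u : H) : (complex.Re `|u|)%:C%C = `|u| by rewrite RRe_real.
apply: (@no_coarse_embedding R p p1 hp H (fun u v => complex.Re (dot u v))).
- by move=> u v; rewrite hermC expr0 mul1r conjRe.
- by move=> u v w; rewrite linearDl ReD.
- by move=> u; rewrite -dotE -normE -rmorphXn /= sqr_ge0.
- by move=> u v; rewrite -ler0c normE.
- by move=> u v; rewrite -dotE -[in RHS]normE -rmorphXn.
Qed.
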